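(* Let $\Gamma=\Gamma_1*_H\Gamma_2$ be a free product of groups $\Gamma_1$ and $\Gamma_2$ with amalgamation over a subgroup $H$ (i.e. $H$ is a common subgroup of $\Gamma_1$ and $\Gamma_2$). Assume that $\Gamma_1$ and $\Gamma_2$ are sofic and that $H$ is a monotileably amenable group. Then $\Gamma$ is sofic.
   Context: For permutations $\sigma,\tau\in S_n$, the normalized Hamming distance $\operatorname{dist}(\sigma,\tau)$ is the number of points not fixed by $\sigma^{-1}\tau$, divided by $n$. A group $\Gamma$ (with identity $e$) is sofic if for every finite subset $F\subseteq\Gamma$ and every $\epsilon>0$ there exist an integer $n\ge 1$ and a map $\phi:\Gamma\to S_n$ such that (i) for every $g\in F\setminus\{e\}$, $\operatorname{dist}(\phi(g),\mathrm{id})>1-\epsilon$, and (ii) for all $g_1,g_2\in F$, $\operatorname{dist}(\phi(g_1^{-1}g_2),\phi(g_1)^{-1}\phi(g_2))<\epsilon$. For a group $G$, a finite set $K\subseteq G$ and $\epsilon>0$, a finite set $F\subseteq G$ is $(K,\epsilon)$-invariant if $|KF\setminus F|<\epsilon|F|$. A tile (or monotile) for $G$ is a finite set $T\subseteq G$ such that $G$ is a disjoint union of right translates of $T$; equivalently, there is a set $C\subseteq G$ (of centers) such that the map $T\times C\to G$, $(t,c)\mapsto tc$, is a bijection. A group $G$ is monotileably amenable if for every finite set $K\subseteq G$ and every $\epsilon>0$ there is a tile $T$ for $G$ that is $(K,\epsilon)$-invariant. *)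

(* Defs.v *)
From HB Require Import structures.
From mathcomp Require Import all_boot all_order all_algebra all_fingroup.
From mathcomp Require Import finmap classical_sets functions reals.
Set Implicit Arguments.
Unset Strict Implicit.
Unset Printing Implicit Defensive.
Import Order.TTheory GRing.Theory Num.Theory.

Local Open Scope classical_set_scope.
Local Open Scope ring_scope.

(* In 'S_n, (s * t) x = t (s x), the opposite of the usual composition order.
   Neither hamming_dist nor sofic depends on the order: s |-> s^-1 is an
   isomorphism between the two group laws and preserves hamming_dist. *)
Definition hamming_dist (R : realType) (n : nat) (s t : 'S_n) : R :=
  #|[pred i : 'I_n | (s^-1 * t)%g i != i]|%:R / n%:R.

Definition sofic (R : realType) (G : groupType) : Prop :=
  forall (F : {fset G}) (eps : R), 0 < eps ->
    exists n : nat, (1 <= n)%N /\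
    exists phi : G -> 'S_n,
      (forall g, g \in F -> g != 1%g -> 1 - eps < hamming_dist R (phi g) 1%g) /\
      (forall g1 g2, g1 \in F -> g2 \in F ->
         hamming_dist R (phi (g1^-1 * g2)%g) ((phi g1)^-1 * phi g2)%g < eps).

Definition fset_mulg (G : groupType) (K F : {fset G}) : {fset G} :=
  [fset (k * f)%g | k in K, f in F]%fset.

Definition left_invariant (R : realType) (G : groupType) (K : {fset G}) (eps : R)
    (F : {fset G}) : Prop :=
  #|` (fset_mulg K F `\` F)%fset|%:R < eps * #|` F|%:R.

Definition tile (G : groupType) (T : {fset G}) : Prop :=
  exists C : set G,
    set_bij ([set` T] `*` C) [set: G] (fun tc : G * G => (tc.1 * tc.2)%g).

Definition monotileably_amenable (R : realType) (G : groupType) : Prop :=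
  forall (K : {fset G}) (eps : R), 0 < eps ->
    exists T : {fset G}, tile T /\ left_invariant K eps T.

(* The common subgroup H is given by injective morphisms j1, j2 into the two
   factors; the amalgamated product is their pushout in the category of
   groups, with i1, i2 the canonical maps of the factors. *)
Definition is_amalgamated_product (H G1 G2 G : groupType)
    (j1 : {multiplicative H -> G1}) (j2 : {multiplicative H -> G2})
    (i1 : {multiplicative G1 -> G}) (i2 : {multiplicative G2 -> G}) : Prop :=
  [/\ injective j1, injective j2,
      i1 \o j1 =1 i2 \o j2 &
      forall (L : groupType)
        (f1 : {multiplicative G1 -> L}) (f2 : {multiplicative G2 -> L}),
        f1 \o j1 =1 f2 \o j2 ->
        exists f : {multiplicative G -> L},
          [/\ f \o i1 =1 f1, f \o i2 =1 f2 &
              forall f' : {multiplicative G -> L},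
                f' \o i1 =1 f1 -> f' \o i2 =1 f2 -> f' =1 f]].

(* Main.v *)
From HB Require Import structures.
From mathcomp Require Import finmap classical_sets boolp functions reals.
From mathcomp Require Import all_boot all_order all_algebra all_fingroup.
From mathcomp Require Import zify lra.
From mathcomp Require Import generic_quotient.
Require Import Defs.

(** The plan is to build, from almost actions of [G1] and [G2] on finite sets, an
    almost action of the two groups on one set in which they agree on [H] and are
    otherwise as independent as possible.

    Amenability of [H] puts the restriction to [H] of any almost action of [Gi] into
    a standard form.  The averaging argument [good_anchor] finds inside every
    remaining part of the space a piece of a Folner translate with small boundary;
    removing such pieces one after the other and filling them with translates of a
    single tile [T] packs almost all of the space ([packing_in]).  Hence the space may
    be taken of the form [Zi * T], where [H] translates [T] and fixes [Zi], while
    elements of [Gi] outside [H] move [Zi] at almost every point ([tiled_action]).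

    Both forms involve the same [T], so they can be glued.  Take a finite group [Q]
    with one involution [u z] for each [z] in the disjoint union of [Z1] and [Z2], such
    that no short product of these with distinct neighbours is trivial
    ([girth_group]).  On [Q * Z1 * Z2 * T] let [Gi] act through [Zi * T], multiplying
    the [Q]-coordinate by [u z' * u z] whenever the [Zi]-coordinate goes from [z] to
    [z'].  The two actions agree on [H]; and a word that alternates between elements
    of [G1] and of [G2] outside [H] multiplies the [Q]-coordinate by a short reduced
    product, so it has hardly any fixed point ([glued_moves]).  Geometrically, the
    blocks of the two spaces are the edges of a bipartite graph of large girth, and an
    alternating word follows a path without backtracking.

    On the algebraic side, the universal property identifies [G] with words modulo the
    congruence generated by the defining relations ([eval_word_faithful]), so equal
    elements are linked by finitely many relations, each of which holds at most points
    of the model ([word_cong_models]).  A shortest word for a nontrivial element is either a single nontrivial letter or alternating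
    with letters outside [H] ([shortest_reduced]); such words move most points.  Thus
    letting each element of [G] act through such a word gives an almost action. *)

Set Implicit Arguments.
Unset Strict Implicit.
Unset Printing Implicit Defensive.

(** * Properties that hold at most points of a finite set *)

(** The integer [q] plays the part of the inverse of an error bound, which keeps
    all estimates in [nat]. *)
Definition mostly (X : finType) (q : nat) (P : pred X) : Prop :=
  q * #|[pred x | ~~ P x]| <= #|X|.

Section Mostly.
Variable X : finType.
Implicit Types (P Q : pred X) (q : nat).

Lemma mostlyW q q' P Q : q <= q' -> (forall x, P x -> Q x) ->
  mostly q' P -> mostly q Q.
Proof.
move=> leq PQ; apply: leq_trans; apply: leq_mul => //.
by apply/subset_leq_card/subsetP => x; rewrite !inE; apply: contra; apply: PQ.
Qed.

Lemma mostly_all (I : eqType) q (s : seq I) (P : I -> pred X) :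
  (forall i, i \in s -> mostly (q * size s) (P i)) ->
  mostly q (fun x => all (P^~ x) s).
Proof.
move=> sP; rewrite /mostly.
have ub : #|[pred x | ~~ all (P^~ x) s]| <= \sum_(i <- s) #|[pred x | ~~ P i x]|.
  elim: s {sP} => [|i s IHs] /=; first by rewrite big_nil eq_card0.
  rewrite big_cons; apply: leq_trans (leq_add (leqnn _) IHs).
  apply: leq_trans (_ : #|[predU [pred x | ~~ P i x] & [pred x | ~~ all (P^~ x) s]]| <= _).
    by apply/subset_leq_card/subsetP => x; rewrite !inE negb_and.
  by rewrite -cardUI leq_addr.
have sumb : q * size s * (\sum_(i <- s) #|[pred x | ~~ P i x]|) <= size s * #|X|.
  move: (q * size s) sP => k sP {ub}; elim: s sP => [|i s IHs] sP /=.
    by rewrite big_nil muln0.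
  rewrite big_cons mulnDr mulSn leq_add ?IHs //; first by apply/sP/mem_head.
  by move=> i' si'; apply: sP; rewrite inE si' orbT.
case: s sP ub sumb => [|i0 s] _ ub sumb.
  by move: ub; rewrite big_nil leqn0 => /eqP ->; rewrite muln0.
rewrite -(@leq_pmul2l (size (i0 :: s))) //; apply: leq_trans sumb.
by rewrite mulnA [X in _ <= X * _]mulnC leq_mul2l ub orbT.
Qed.

Lemma mostlyI q P Q :
  mostly (2 * q) P -> mostly (2 * q) Q -> mostly q (fun x => P x && Q x).
Proof.
move=> mP mQ.
have mPQ : mostly q (fun x => all (fun b : bool => (if b then P else Q) x) [:: true; false]).
  by apply: mostly_all => b _; rewrite /= mulnC; case: b.
by apply: mostlyW (leqnn q) _ mPQ => x /=; rewrite andbT.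
Qed.

(** An injective self-map of a finite set is a permutation, so it preserves the
    size of the exceptional set.  This is what lets a condition be required at
    each point that a word visits. *)
Lemma mostly_comp q P (f : X -> X) :
  injective f -> mostly q P -> mostly q (fun x => P (f x)).
Proof.
move=> injf; rewrite /mostly -[in X in _ -> X](card_image injf).
apply: leq_trans; rewrite leq_mul2l subset_leq_card ?orbT //.
by apply/subsetP => _ /imageP[x Px ->].
Qed.

End Mostly.

Lemma mostly_fst (X Y W : finType) q (P : pred Y) (e : X -> Y * W) :
  bijective e -> mostly q P -> mostly q (fun x => P (e x).1).
Proof.
move=> bije; rewrite /mostly (bij_eq_card bije) card_prod => mP.
apply: leq_trans (leq_mul mP (leqnn _)); rewrite -[leqRHS]mulnA leq_mul2l; apply/orP; right.
rewrite -cardX -(card_image (bij_inj bije)); apply/subset_leq_card/subsetP.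
by move=> _ /imageP[x nPx ->]; rewrite !inE andbT in nPx *.
Qed.

(** * Soficity by almost actions *)

Section AlmostAction.
Variables (G : groupType) (X : finType) (A : G -> X -> X).

Definition mult_at (M : seq G) (x : X) : bool :=
  all (fun g => all (fun h => A (g * h)%g x == A g (A h x)) M) M.

Definition free_at (M : seq G) (x : X) : bool :=
  all (fun g => (g == 1%g) || (A g x != x)) M.

Definition regular (M : seq G) (x : X) : bool :=
  mult_at M x && all (fun g => all (fun h => (A g x == A h x) ==> (g == h)) M) M.

Lemma mult_atP M x : reflect {in M &, forall g h, A (g * h)%g x = A g (A h x)} (mult_at M x).
Proof.
apply: (iffP allP) => [mM g h Mg Mh|mM g Mg].
  by apply/eqP; apply: (allP (mM g Mg)).
by apply/allP => h Mh; rewrite mM.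
Qed.

Lemma regularP M x :
  reflect ({in M &, forall g h, A (g * h)%g x = A g (A h x)} /\ {in M &, injective (A^~ x)})
          (regular M x).
Proof.
apply: (iffP andP) => -[mM iM]; (split; first exact/mult_atP).
  by move=> g h Mg Mh /eqP gh; apply/eqP; move/allP/(_ g Mg)/allP/(_ h Mh)/implyP/(_ gh): iM.
by apply/allP => g Mg; apply/allP => h Mh; apply/implyP => /eqP /iM -> .
Qed.

(** Almost multiplicativity turns a coincidence [A g x = A h x] into a fixed point
    of [g^-1 * h]; hence the quotients of elements of [M] are added to [M]. *)
Lemma mult_free_regular M : (forall g, injective (A g)) ->
  let N := M ++ [seq (g^-1 * h)%g | g <- M, h <- M] in
  forall x, mult_at N x && free_at N x -> regular M x.
Proof.
move=> injA N x /andP[/mult_atP mN /allP fN].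
have sMN g : g \in M -> g \in N by rewrite mem_cat => ->.
apply/regularP; split=> [g h Mg Mh|g h Mg Mh /= Agh]; first by apply: mN; apply: sMN.
have Nk : (g^-1 * h)%g \in N by rewrite mem_cat (allpairs_f (fun g h => (g^-1 * h)%g) Mg Mh) orbT.
case/orP: (fN _ Nk) => [/eqP k1|/eqP[]].
  by rewrite -[h](mulVKg g) k1 mulg1.
by apply: (injA g); rewrite -mN ?mulVKg //; apply: sMN.
Qed.

End AlmostAction.

Definition has_almost_actions (G : groupType) : Prop :=
  forall (M : seq G) (q : nat), exists (X : finType) (A : G -> X -> X),
    [/\ 0 < #|X|, forall g, injective (A g) & mostly q (regular A M)].

Section SoficActions.
Import Order.TTheory GRing.Theory Num.Theory.
Local Open Scope ring_scope.
Variable R : realType.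

Lemma hamming_distE n (s t : 'S_n) :
  hamming_dist R s t = #|[pred i | ~~ (t ((s^-1)%g i) == i)]|%:R / n%:R.
Proof. by congr (_%:R / _); apply: eq_card => i; rewrite !inE permM. Qed.

Lemma mostly_lt (X : finType) q (P : pred X) (eps : R) :
  (0 < #|X|)%N -> 1 < q%:R * eps -> mostly q P ->
  #|[pred x | ~~ P x]|%:R / #|X|%:R < eps.
Proof.
rewrite /mostly -(ltr0n R) -(ler_nat R) natrM => X0 qe mP.
rewrite ltr_pdivrMr //; set c := _%:R in mP *.
have c0 : 0 <= c by rewrite ler0n.
have q0 : 0 <= q%:R :> R by rewrite ler0n.
nra.
Qed.

Lemma lt_mostly (X : finType) q (P : pred X) :
  (0 < #|X|)%N -> #|[pred x | ~~ P x]|%:R / #|X|%:R < q.+1%:R^-1 :> R -> mostly q P.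
Proof.
rewrite /mostly -(ltr0n R) => X0; rewrite ltr_pdivrMr // mulrC ltr_pdivlMr ?ltr0n //.
rewrite -natrM ltr_nat => /ltnW; apply: leq_trans; rewrite mulnC.
by rewrite leq_mul2l leqnSn orbT.
Qed.

(** Since products of permutations compose from left to right, the left almost
    action attached to [phi] is [g |-> (phi g)^-1]. *)
Lemma sofic_almost_action (G : groupType) : sofic R G -> has_almost_actions G.
Proof.
move=> sG M0 q0.
set M := M0 ++ [seq (g^-1 * h)%g | g <- M0, h <- M0].
set q := (2 * q0)%N.
pose N := M ++ [seq (g * h)%g | g <- M, h <- M].
pose k := (q * size N * size N)%N.
have [|n [n0 [phi [phiF phiM]]]] := sG [fset g in N]%fset k.+1%:R^-1.
  by rewrite invr_gt0 ltr0n.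
have In0 : (0 < #|'I_n|)%N by rewrite card_ord.
pose A g : 'I_n -> 'I_n := ((phi g)^-1)%g.
have injA g : injective (A g) by apply: perm_inj.
exists 'I_n, A; split=> //.
apply: mostlyW (leqnn q0) (mult_free_regular injA) _.
apply: mostlyI.
  rewrite -/q -/M; apply: mostly_all => g Mg; apply: mostly_all => h Mh.
  have szM : (size M <= size N)%N by rewrite [leqRHS]size_cat leq_addr.
  apply: (@mostlyW _ _ k (fun x => A (g * h)%g x == A g (A h x))) => //.
    by rewrite /k !leq_mul.
  apply: lt_mostly => //; rewrite card_ord.
  have Ng : g \in N by rewrite mem_cat Mg.
  have Ngh : (g * h)%g \in N.
    by rewrite mem_cat (allpairs_f (fun g h => (g * h)%g) Mg Mh) orbT.
  (* The pair (g, g h) in the soficity condition compares phi h with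
     (phi g)^-1 phi (g h), which is multiplicativity at (g, h). *)
  have := phiM g (g * h)%g; rewrite !in_fset => /(_ Ng Ngh).
  rewrite mulKg hamming_distE; congr (_%:R / _ < _).
  apply: eq_card => x; rewrite !inE permM; congr (~~ _).
  apply/eqP/eqP => E; first by rewrite -{1}E /A permK.
  by rewrite -[X in phi _ X]E permKV.
rewrite -/q -/M; apply: mostly_all => g Mg.
have szM : (size M <= size N)%N by rewrite [leqRHS]size_cat leq_addr.
case: eqP => [_|/eqP g1] /=; first by rewrite /mostly eq_card0 ?muln0.
apply: (@mostlyW _ _ k (fun x => A g x != x)) => //.
  have N0 : (0 < size N)%N by apply: leq_trans szM; case: (M) Mg.
  by apply: leq_trans (leq_pmulr _ N0); rewrite leq_mul2l szM orbT.
apply: lt_mostly => //; rewrite card_ord.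
have := phiF g; rewrite in_fset mem_cat Mg => /(_ isT g1).
rewrite hamming_distE ltrBlDr -ltrBlDl; apply: le_lt_trans.
rewrite lerBrDr -mulrDl -natrD ler_pdivrMr ?ltr0n // mul1r ler_nat.
rewrite -[X in (_ <= X)%N](card_ord n) -(cardC [pred i | A g i == i]).
by rewrite leq_add //; apply/subset_leq_card/subsetP => x; rewrite !inE ?negbK ?perm1.
Qed.

(** For [s = phi (g1^-1 * g2)] and [t = (phi g1)^-1 * phi g2] with [phi g] the inverse
    of [A g], a point not fixed by [s^-1 * t] is one where [A g2] differs from
    [A g1 \o A (g1^-1 * g2)]. *)
Lemma almost_action_sofic (G : groupType) :
  (forall (M : seq G) (q : nat), exists (X : finType) (A : G -> X -> X),
    [/\ (0 < #|X|)%N, forall g, injective (A g), mostly q (mult_at A M)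
      & mostly q (free_at A M)]) ->
  sofic R G.
Proof.
move=> aG F eps eps0.
pose N : seq G := F ++ [seq (g^-1 * h)%g | g <- F, h <- F].
pose q := Num.bound eps^-1.
have qe : 1 < q%:R * eps.
  by rewrite -ltr_pdivrMr // div1r archi_boundP // invr_ge0 ltW.
have [X [A [X0 injA multA freeA]]] := aG N q.
exists #|X|; split=> //.
pose P g : 'S_#|X| := perm (inj_comp enum_rank_inj (inj_comp (injA g) (@enum_val_inj _ X))).
have PE g i : P g i = enum_rank (A g (enum_val i)) by rewrite permE.
exists (fun g => (P g)^-1)%g.
have tr (f : pred X) : #|[pred i : 'I_#|X| | f (enum_val i)]| = #|[pred x | f x]|.
  rewrite -[LHS](card_image (@enum_val_inj _ _)); apply: eq_card => x.
  rewrite !inE; apply/imageP/idP => [[i fi ->]//|fx].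
  by exists (enum_rank x); rewrite ?inE ?enum_rankK.
split=> [g Fg g1|g1 g2 Fg1 Fg2].
  have Ng : g \in N by rewrite mem_cat Fg.
  have : mostly q (fun x => A g x != x).
    by apply: mostlyW freeA => // x /allP/(_ _ Ng); rewrite (negPf g1).
  move=> /(mostly_lt X0 qe); rewrite hamming_distE ltrBlDr -ltrBlDl.
  apply: le_lt_trans; rewrite lerBlDr -mulrDl -natrD ler_pdivlMr ?ltr0n // mul1r ler_nat.
  apply: leq_trans (eq_leq (esym (cardC [pred x | A g x == x]))) _.
  apply: leq_add; apply: eq_leq.
    by apply: eq_card => x; rewrite !inE negbK.
  rewrite -[LHS](tr [pred x | A g x != x]); apply: eq_card => i.
  by rewrite !inE perm1 invgK PE -(inj_eq enum_val_inj) enum_rankK.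
have Ng : (g1^-1 * g2)%g \in N.
  by rewrite mem_cat (allpairs_f (fun g h => (g^-1 * h)%g) Fg1 Fg2) orbT.
have : mostly q (fun x => A g2 x == A g1 (A (g1^-1 * g2)%g x)).
  apply: mostlyW multA => // x /mult_atP mN.
  by rewrite -mN ?mulVKg // mem_cat Fg1.
move=> /(mostly_lt X0 qe); rewrite hamming_distE; apply: le_lt_trans.
rewrite ler_pM2r ?invr_gt0 ?ltr0n // ler_nat; apply: eq_leq.
rewrite -[RHS](tr [pred x | A g2 x != A g1 (A (g1^-1 * g2)%g x)]).
apply: eq_card => i; rewrite !inE; congr (~~ _).
rewrite permM !invgK PE PE enum_rankK -(inj_eq (@perm_inj _ (P g2))) permKV PE.
by rewrite (inj_eq enum_rank_inj) eq_sym.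
Qed.

End SoficActions.


(** * Packing an almost free almost action by translates of a tile *)

(** Here [T] is a tile with set of centers [C], and [F] is a finite set whose
    elements mostly satisfy [T T^-1 f `<=` F].  The translates of [F] cut the space
    into pieces, and each piece is filled with translates of [T]: the tiling of [H]
    places them inside [F], and transport to the space needs only the finitely many
    products collected in [M]. *)
Section Tiling.
Variables (H : groupType) (X : finType) (A : H -> X -> X).
Hypothesis injA : forall h, injective (A h).
Variables (T F : {fset H}) (C : set H) (q : nat) (M : seq H).
Hypothesis T_covers : forall h, exists2 t, t \in T & C (t^-1 * h)%g.
Hypothesis T_packs : forall t t' c c', t \in T -> t' \in T -> C c -> C c' ->
  (t * c = t' * c')%g -> c = c'.
Hypothesis F_gt0 : 0 < #|{: F}|.
Let K := [seq (t * t'^-1)%g | t <- T, t' <- T].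
Hypothesis F_inv : mostly q (fun f : F => all (fun k => (k * val f)%g \in F) K).
Let TVF := [seq (t^-1 * f)%g | t <- T, f <- F].
Hypothesis sTM : {subset T <= M}.
Hypothesis sVM : {subset TVF <= M}.
Hypothesis sTVM : {subset [seq (t * c)%g | t <- T, c <- TVF] <= M}.

Let bad := #|[pred x | ~~ regular A M x]|.
Let inner (f : F) := all (fun k => (k * val f)%g \in F) K.
Let hits (Y : {set X}) (x : X) := #|[set f : F | A (val f) x \in Y]|.
Let edge_hits (Y : {set X}) (x : X) := #|[set f : F | ~~ inner f & A (val f) x \in Y]|.

(** The block of [z] is the set of all [A t z] with [t] in [T].  Counting the cut
    blocks, rather than the points near a boundary, makes the notion symmetric
    between a set and its complement, and so lets the induction in [packing_in]
    charge the same blocks to either side. *)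
Definition meets (Y : {set X}) (z : X) := [exists t : T, A (val t) z \in Y].
Definition cut (Y : {set X}) : {set X} :=
  [set z | meets Y z & ~~ [forall t : T, A (val t) z \in Y]].

Lemma sum_card_hits (P : pred F) (Y : {set X}) :
  \sum_x #|[set f : F | P f & A (val f) x \in Y]| = #|P| * #|Y|.
Proof.
transitivity (\sum_x \sum_(f | P f) (A (val f) x \in Y : nat)).
  by apply: eq_bigr => x _; rewrite -sum1dep_card big_mkcondr.
rewrite exchange_big /= -sum_nat_const; apply: eq_bigr => f _.
rewrite -big_mkcond /= sum1dep_card; apply: etrans (on_card_preimset _).
  by apply: eq_card => x; rewrite !inE.
by apply: onW_bij; apply: injF_bij; apply: injA.
Qed.

(** Averaging over the anchor [x]: the hits of all of [F] add up to [#|F| * #|Y|]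
    and those of the non-inner elements of [F] to at most a [q]-th part of it.  The
    factor 2 absorbs the anchors that are not regular. *)
Lemma good_anchor (Y : {set X}) : 2 * bad < #|Y| ->
  exists x, [/\ regular A M x, 0 < hits Y x & q * edge_hits Y x <= 2 * hits Y x].
Proof.
move=> ltY.
case: (pickP [pred x | [&& regular A M x, 0 < hits Y x & q * edge_hits Y x <= 2 * hits Y x]]).
  by move=> x /and3P[]; exists x.
move=> none.
have few : \sum_(x | regular A M x) 2 * hits Y x <= #|{: F}| * #|Y|.
  apply: leq_trans (_ : \sum_x q * edge_hits Y x <= _); last first.
    rewrite -big_distrr /= (sum_card_hits (fun f => ~~ inner f)) mulnA leq_mul2r.
    by apply/orP; right; apply: leq_trans F_inv; rewrite leq_mul2l; apply/orP; right.
  rewrite big_mkcond; apply: leq_sum => x _; case: ifP => // regx.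
  move/negbT: (none x); rewrite /= regx /= negb_and -eqn0Ngt -ltnNge.
  by case/orP => [/eqP ->|/ltnW]; rewrite ?muln0.
have all_hits : \sum_x hits Y x = #|{: F}| * #|Y|.
  by rewrite -(sum_card_hits predT); apply: eq_bigr => x _; apply: eq_card => f; rewrite !inE.
have bad_hits : \sum_(x | ~~ regular A M x) hits Y x <= bad * #|{: F}|.
  rewrite -sum_nat_const; apply: leq_sum => x _.
  by apply: leq_trans (max_card _) _.
move: all_hits; rewrite (bigID (regular A M)) /= => all_hits.
move: few; rewrite -big_distrr /= => few; nia.
Qed.

(** A block cut by both parts of a partition of [Y] either meets both parts, or is
    already cut by [Y] and belongs to just one of them. *)
Lemma split_cut (B Y : {set X}) : B \subset Y ->
  #|cut B| + #|cut (Y :\: B)| <= #|cut Y| + 2 * #|[set z | meets B z & meets (Y :\: B) z]|.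
Proof.
move=> sBY; set Y' := Y :\: B; set I := [set z | _ & _].
set D1 := [set z in cut Y | ~~ meets Y' z]; set D2 := [set z in cut Y | meets Y' z].
have cutB : cut B \subset I :|: D1.
  apply/subsetP => z; rewrite !inE => /andP[mB nB]; rewrite mB /=.
  case: (boolP (meets Y' z)) => //= nY'; rewrite andbT; apply/andP; split.
    by case/existsP: mB => t Bt; apply/existsP; exists t; apply: (subsetP sBY).
  apply: contra nB => /forallP allY; apply/forallP => t.
  by apply: contraNT nY' => nBt; apply/existsP; exists t; rewrite inE nBt allY.
have cutY' : cut Y' \subset I :|: D2.
  apply/subsetP => z; rewrite !inE => /andP[mY' nY']; rewrite mY' !andbT.
  case: (boolP (meets B z)) => //= nB; apply/andP; split.
    by case/existsP: mY' => t; rewrite inE => /andP[_ Yt]; apply/existsP; exists t.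
  apply: contra nY' => /forallP allY; apply/forallP => t; rewrite inE allY andbT.
  by apply: contra nB => Bt; apply/existsP; exists t.
have -> : #|cut Y| = #|D1| + #|D2|.
  rewrite -(cardsID [set z | ~~ meets Y' z] (cut Y)); congr (_ + _); apply: eq_card => z.
    by rewrite !inE.
  by rewrite !inE negbK andbC.
apply: leq_trans (leq_add (subset_leq_card cutB) (subset_leq_card cutY')) _.
have := leq_add (leq_card_setU I D1) (leq_card_setU I D2); lia.
Qed.

Let T_gt0 : 0 < #|{: T}|.
Proof. by have [t Tt _] := T_covers 1; apply/card_gt0P; exists [` Tt]%fset. Qed.

(** Remove from [Y] the piece [B] of [Y] in a translate [F x] chosen by
    [good_anchor], and fill [B] with the blocks of the tiling of [H] that lie in it.
    A point of [B] that remains uncovered lies in a cut block, and the new cut blocks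
    meet both [B] and the rest of [Y]; such a block contains a point [A f x] with [f]
    not inner, so there are at most [2 * #|T| * #|B| / q] of them. *)
Lemma packing_in (Y : {set X}) : exists Z : {set X},
  [/\ {in Z &, forall z z' (t t' : T), A (val t) z = A (val t') z' -> z = z' /\ t = t'},
      forall z (t : T), z \in Z -> A (val t) z \in Y
    & q * #|Y| <= q * #|{: T}| * #|Z| + q * #|{: T}| * #|cut Y| + 4 * #|{: T}| ^ 2 * #|Y| + 2 * q * bad].
Proof.
have [n leYn] := ubnP #|Y|; elim: n Y leYn => // n IHn Y /ltnSE-leYn.
have [smallY|bigY] := leqP #|Y| (2 * bad).
  exists set0; split=> [z|z t|]; rewrite ?inE //.
  by apply: leq_trans (leq_addl _ _); rewrite mulnAC [X in _ <= X]mulnC leq_mul2l smallY orbT.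
have [x [/regularP[multx injx] hitx edgex]] := good_anchor bigY.
set B := [set y in Y | [exists f : F, A (val f) x == y]].
set Y' := Y :\: B.
have sBY : B \subset Y by apply/subsetP => y; rewrite inE => /andP[].
have memF (t : T) (f : F) : val f = (val t * ((val t)^-1 * val f))%g by rewrite mulVKg.
have TVFP (t : T) (f : F) : ((val t)^-1 * val f)%g \in TVF.
  exact: (allpairs_f (fun t f => (t^-1 * f)%g) (valP t) (valP f)).
have TTVFP (t t' : T) (f : F) : (val t * ((val t')^-1 * val f))%g \in M.
  by apply: sTVM; apply: (allpairs_f (fun t c => (t * c)%g) (valP t) (TVFP t' f)).
have actM (t t' : T) (f : F) :
    A (val t) (A ((val t')^-1 * val f)%g x) = A (val t * ((val t')^-1 * val f))%g x.
  by rewrite (multx _ _ (sTM (valP t)) (sVM (TVFP t' f))).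
have [t0 _] := card_gt0P T_gt0.
have FM (f : F) : val f \in M by rewrite (memF t0).
have cardB : #|B| = hits Y x.
  rewrite /hits -(card_in_imset (f := fun f : F => A (val f) x)); last first.
    by move=> f g _ _ /(injx _ _ (FM f) (FM g)) /val_inj.
  apply: eq_card => y; rewrite inE; apply/andP/imsetP => [[Yy /existsP[f /eqP fy]]|[f + ->]].
    by exists f; rewrite ?inE ?fy.
  by rewrite inE => Yf; split=> //; apply/existsP; exists f.
have cardY : #|Y| = #|B| + #|Y'| by rewrite -(cardsID B Y) (setIidPr sBY).
have [|Z' [injZ' blkZ' leZ']] := IHn Y'; first by lia.
(* z is the translate by x of a center of the tiling of H near F *)
pose isC z := [exists t : T, [exists f : F,
  `[< C ((val t)^-1 * val f)%g >] && (z == A ((val t)^-1 * val f)%g x)]].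
pose ZB := [set z | isC z & [forall t : T, A (val t) z \in B]].
have ZBB z : z \in ZB -> forall t : T, A (val t) z \in B by rewrite inE => /andP[_ /forallP].
have ZBC z : z \in ZB -> exists (t : T) (f : F), C ((val t)^-1 * val f)%g /\ z = A ((val t)^-1 * val f)%g x.
  by rewrite inE => /andP[/existsP[t /existsP[f /andP[/asboolP Cc /eqP ->]]] _]; exists t, f.
have disj z z' (t t' : T) : z \in ZB -> z' \in Z' -> A (val t) z <> A (val t') z'.
  by move=> /ZBB/(_ t) Bz /(blkZ' _ t'); rewrite inE => /andP[nB _] E; rewrite -E Bz in nB.
have cardZ : #|ZB :|: Z'| = #|ZB| + #|Z'|.
  apply/eqP; rewrite (leq_card_setU _ _).2; apply/pred0P => z /=; apply/negbTE/andP => -[ZBz Z'z].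
  exact: (disj z z t0 t0).
exists (ZB :|: Z'); split=> [z z' + + t t' E|z t|].
- rewrite !in_setU => /orP[Zz|Zz] /orP[Zz'|Zz'].
  + have [s [f [Cz Ez]]] := ZBC z Zz; have [s' [f' [Cz' Ez']]] := ZBC z' Zz'.
    move: E; rewrite Ez Ez' !actM => /injx; rewrite !TTVFP => /(_ isT isT) E.
    have Ec := T_packs (valP t) (valP t') Cz Cz' E.
    by split; [rewrite Ec | rewrite Ec in E; apply/val_inj/(mulIg _ _ _ E)].
  + by case: (disj z z' t t').
  + by case: (disj z' z t' t).
  + exact: injZ'.
- rewrite in_setU => /orP[/ZBB/(_ t) Bt|/(blkZ' _ t)]; first exact: (subsetP sBY).
  by rewrite inE => /andP[].
have coverB : #|B| <= #|{: T}| * (#|ZB| + #|cut B|).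
  apply: leq_trans (_ : #|[set A (val p.1) p.2 | p : T * X in setX [set: T] (ZB :|: cut B)]| <= _).
    apply/subset_leq_card/subsetP => b Bb; move: (Bb).
    rewrite inE => /andP[_ /existsP[f /eqP fb]].
    have [t Tt Ct] := T_covers (val f).
    pose t' : T := [` Tt]%fset; pose z := A ((val t')^-1 * val f)%g x.
    have bE : b = A (val t') z by rewrite /z actM -memF fb.
    apply/imsetP; exists (t', z) => //=; rewrite !inE /=.
    case: (boolP [forall s : T, A (val s) z \in B]) => nB.
      rewrite andbT; apply/orP; left; apply/existsP; exists t'; apply/existsP; exists f.
      by rewrite eqxx andbT; apply/asboolP.
    by rewrite andbT; apply/orP; right; apply/existsP; exists t'; rewrite -bE.
  apply: leq_trans (leq_imset_card _ _) _.
  by rewrite cardsX cardsT leq_mul2l leq_card_setU orbT.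
set I := #|[set z | meets B z & meets Y' z]|.
have leI : I <= #|{: T}| * edge_hits Y x.
  apply: leq_trans (_ : #|[set A ((val p.1)^-1 * val p.2)%g x | p : T * F in
    setX [set: T] [set f : F | ~~ inner f & A (val f) x \in Y]]| <= _); last first.
    by apply: leq_trans (leq_imset_card _ _) _; rewrite cardsX cardsT.
  apply/subset_leq_card/subsetP => z; rewrite inE => /andP[/existsP[t]].
  rewrite inE => /andP[Yt /existsP[f /eqP fE]] /existsP[t' Y't'].
  have zE : z = A ((val t)^-1 * val f)%g x.
    by apply: (injA (h := val t)); rewrite actM -memF.
  apply/imsetP; exists (t, f) => //; rewrite !inE /= fE Yt andbT.
  apply/allPn; exists (val t' * (val t)^-1)%g.
    exact: (allpairs_f (fun t t' => (t * t'^-1)%g) (valP t') (valP t)).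
  apply: contraL Y't' => Fg; rewrite inE negb_and negbK inE.
  apply/orP; case: (boolP (_ \in Y)) => Yz; [left | by right].
  rewrite ?Yz /=; apply/existsP; exists [` Fg]%fset.
  by rewrite /= -mulgA -actM zE.
have := split_cut sBY; rewrite -/Y' -/I => leCut.
rewrite cardZ cardY.
move: (#|cut B|) (#|cut Y'|) (#|cut Y|) (#|{: T}|) leCut leI coverB leZ' edgex cardB.
move=> cB cY' cY tau; rewrite !expnS expn0 muln1 => leCut leI coverB leZ' edgex cardB.
have h1 := leq_mul (leqnn q) coverB.
have h2 := leq_mul (leqnn (q * tau)) leCut.
have h3 := leq_mul (leqnn (2 * tau * q)) leI.
have h4 := leq_mul (leqnn (2 * tau * tau)) edgex.
rewrite cardB in h1 *; lia.
Qed.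

End Tiling.

Definition has_monotiles (H : groupType) : Prop :=
  forall (K : seq H) (q : nat), exists T : {fset H},
    tile T /\ mostly q (fun t : T => all (fun k => (k * val t)%g \in T) K).

Section Monotile.
Import Order.TTheory GRing.Theory Num.Theory.
Variables (R : realType) (H : groupType).

Lemma almost_invariant_monotile : monotileably_amenable R H -> has_monotiles H.
Proof.
move=> aH K q; pose r := (q * size K).+1.
have [|T [tT iT]] := aH [fset k in K]%fset r%:R^-1%R; first by rewrite invr_gt0 ltr0n.
exists T; split=> //; apply: mostly_all => k Kk.
move: iT; rewrite /left_invariant mulrC ltr_pdivlMr ?ltr0n // -natrM ltr_nat mulnC.
rewrite [in X in _ < X]cardfE => /ltnW; apply: leq_trans.
apply: leq_mul (leqnSn _) _; rewrite cardE -(size_map (fun t : T => (k * val t)%g)).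
rewrite uniq_leq_size // ?map_inj_uniq ?enum_uniq //.
  by move=> t t' /mulgI/val_inj.
move=> _ /mapP[t nT ->]; rewrite mem_enum inE in nT.
rewrite in_fsetD nT /=; apply/imfset2P; exists k; first by rewrite in_fset.
by exists (val t); first exact: valP.
Qed.

End Monotile.

Lemma tile_centers (H : groupType) (T : {fset H}) : tile T ->
  exists C : set H,
    (forall h, exists2 t, t \in T & C (t^-1 * h)%g) /\
    (forall t t' c c', t \in T -> t' \in T -> C c -> C c' -> (t * c = t' * c')%g -> c = c').
Proof.
case=> C [_ injC surC]; exists C; split=> [h|t t' c c' Tt Tt' Cc Cc' E].
  have [[t c] [/= Tt Cc] <-] := surC h I.
  by exists t; rewrite // mulKg.
have memTC u d : u \in T -> C d -> (u, d) \in ([set` T] `*` C)%classic.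
  by move=> Tu Cd; rewrite in_setE.
by have [] := injC (t, c) (t', c') (memTC _ _ Tt Cc) (memTC _ _ Tt' Cc') E.
Qed.

(** * Almost actions in which the subgroup translates the tile *)

Section TiledAction.
Variables (H G : groupType) (j : {multiplicative H -> G}).
Hypothesis injj : injective j.

(** On [Z * T] the subgroup moves only the [T]-coordinate, by left translation, while
    the elements outside the subgroup always change the [Z]-coordinate. *)
Definition tiled_at (T : {fset H}) (Z : finType) (psi : G -> Z * T -> Z * T)
    (M : seq G) (K : seq H) (y : Z * T) : bool :=
  [&& mult_at psi M y, free_at psi M y,
      all (fun h => ((psi (j h) y).1 == y.1) && (val (psi (j h) y).2 == (h * val y.2)%g)) K
    & all (fun g => `[< exists h, j h = g >] || ((psi g y).1 != y.1)) M].

Hypothesis soficG : has_almost_actions G.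
Hypothesis amenH : has_monotiles H.

Lemma tile_gt0 (T : {fset H}) : tile T -> 0 < #|{: T}|.
Proof.
case/tile_centers => C [covC _]; have [t Tt _] := covC 1%g.
by apply/card_gt0P; exists [` Tt]%fset.
Qed.

(** Packing for the restricted action [A \o j], with a Folner set of [H] so
    invariant that the packing misses at most a [p]-th part of the points. *)
Lemma almost_tiling (T : {fset H}) (M : seq G) (p : nat) : tile T -> 
  exists (X : finType) (A : G -> X -> X) (Z : {set X}),
    [/\ 0 < #|X|, forall g, injective (A g), mostly p (regular A M),
      {in Z &, forall z z' (t t' : T), A (j (val t)) z = A (j (val t')) z' -> z = z' /\ t = t'}
    & mostly p (fun x => [exists t : T, [exists z in Z, A (j (val t)) z == x]])].
Proof.
move=> tT; have [C [covC packC]] := tile_centers tT.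
have T_gt0 := tile_gt0 tT; set tau := #|_| in T_gt0.
pose K := [seq (t * t'^-1)%g | t <- T, t' <- T].
(* The packing misses a part 4 tau^2 / (8 tau^2 p) = 1 / (2 p) of the space, and twice
   the irregular points, which the scale 4 p keeps below another 1 / (2 p). *)
have [F [tF iF]] := amenH K (8 * tau ^ 2 * p).
have F_gt0 := tile_gt0 tF.
pose TVF := [seq (t^-1 * f)%g | t <- T, f <- F].
pose TTVF := [seq (t * c)%g | t <- T, c <- TVF].
pose N : seq H := T ++ TVF ++ TTVF.
have [X [A [X_gt0 injA regA]]] := soficG (M ++ map j N) (4 * p).
have regN x : regular A (M ++ map j N) x -> regular (A \o j) N x.
  have sN h : h \in N -> j h \in M ++ map j N by move=> Nh; rewrite mem_cat map_f ?orbT.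
  case/regularP=> mult inj; apply/regularP; split=> [g h Ng Nh|g h Ng Nh /inj].
    by rewrite /= gmulfM mult ?sN.
  by rewrite !sN // => /(_ isT isT) /injj.
have [|||Z [injZ _]] := @packing_in H X (A \o j) (fun h => injA (j h)) T F C _ N
  covC packC F_gt0 iF _ _ _ [set: X].
- by move=> h Th; rewrite mem_cat Th.
- by move=> h Th; rewrite !mem_cat Th orbT.
- by move=> h Th; rewrite !mem_cat Th !orbT.
have -> : cut (A \o j) T [set: X] = set0.
  apply/setP => z; rewrite !inE; apply/negbTE; rewrite negb_and negbK; apply/orP; right.
  by apply/forallP => t; rewrite inE.
rewrite cards0 muln0 addn0 cardsT -/tau => leZ.
exists X, A, Z; split=> //.
  apply: mostlyW (leq_pmull _ _) _ regA => // x /regularP[mult inj]; apply/regularP.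
  split=> [g h Mg Mh|g h Mg Mh /inj]; last by apply; rewrite mem_cat ?Mg ?Mh.
  by rewrite mult // mem_cat ?Mg ?Mh.
have {}regN : mostly (4 * p) (regular (A \o j) N) by apply: mostlyW regA.
rewrite /mostly in regN *; set b := #|_| in leZ regN *; set r := #|_|.
have XE : #|X| = tau * #|Z| + r.
  rewrite -(cardC [pred x | [exists t : T, [exists z in Z, A (j (val t)) z == x]]]); congr (_ + _).
  rewrite -[tau]cardsT -cardsX -(card_in_imset (f := fun p : T * X => A (j (val p.1)) p.2)).
    apply: eq_card => x; rewrite inE; apply/existsP/imsetP => [[t /exists_inP[z Zz /eqP <-]]|[[t z]]].
      by exists (t, z); rewrite ?inE.
    by rewrite !inE /= => Zz ->; exists t; apply/exists_inP; exists z.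
  move=> [t z] [t' z']; rewrite !inE /= => Zz Zz' E.
  by have [-> ->] := injZ _ _ Zz Zz' _ _ E.
move: leZ regN; rewrite XE expnS expn1 => leZ regN.
have t2 : 0 < 8 * (tau * tau) by rewrite !muln_gt0 T_gt0.
rewrite -(leq_pmul2l t2).
have := leq_mul (leqnn (4 * (tau * tau))) regN; lia.
Qed.


(** Conjugate of [f] by the injection [iota], extended by the identity outside the
    image of [iota]; [kappa] is the partial inverse of [iota]. *)
Definition conj_map (X Y : finType) (kappa : Y -> option X) (iota : X -> Y) (f : X -> X) (y : Y) : Y :=
  if kappa y is Some x then iota (f x) else y.

Lemma conj_map_inj (X Y : finType) (kappa : Y -> option X) (iota : X -> Y) (f : X -> X) :
  (forall x, kappa (iota x) = Some x) -> (forall x y, kappa y = Some x -> iota x = y) ->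
  injective f -> injective (conj_map kappa iota f).
Proof.
move=> iotaK kappaK injf y y'; rewrite /conj_map.
case Ey: (kappa y) => [x|]; case Ey': (kappa y') => [x'|] //.
- by move/(congr1 kappa); rewrite !iotaK => -[/injf xx']; rewrite -(kappaK _ _ Ey) xx' (kappaK _ _ Ey').
- by move=> E; rewrite -E iotaK in Ey'.
- by move=> E; rewrite E iotaK in Ey.
Qed.

(** Each uncovered point of an almost tiling gets a copy of [T] of its own, in which
    it sits at [t0] and all other points are fixed.  The space then becomes exactly
    [Z * T], with no leftover to keep track of, at the price of [#|T|] points for each
    uncovered one. *)
Lemma tiled_action (T : {fset H}) (M : seq G) (K : seq H) (q : nat) : tile T ->
  mostly (4 * q) (fun t : T => all (fun k => (k * val t)%g \in T) K) ->
  exists (Z : finType) (psi : G -> Z * T -> Z * T),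
    [/\ 0 < #|Z|, forall g, injective (psi g) & mostly q (tiled_at psi M K)].
Proof.
move=> tT iT; have T_gt0 := tile_gt0 tT; have [t0 _] := card_gt0P T_gt0.
(* Four kinds of points are lost, hence the factor 4; an uncovered point, or an
   irregular center, spoils #|T| points of the new space. *)
pose p := 4 * q * #|{: T}|.
have leqp : 4 * q <= p by rewrite leq_pmulr.
pose jT := [seq j t | t <- T].
pose N := 1%g :: M ++ jT ++ [seq j k | k <- K] ++ [seq (g * t)%g | g <- M, t <- jT].
have [X [A [Z0 [X_gt0 injA regA injZ tileX]]]] := almost_tiling N p tT.
pose covered x := [exists t : T, [exists z in Z0, A (j (val t)) z == x]].
pose Z := ({z | z \in Z0} + {x | ~~ covered x})%type : finType.
pose kappa (y : Z * T) : option X :=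
  match y.1 with
  | inl z => Some (A (j (val y.2)) (val z))
  | inr x => if y.2 == t0 then Some (val x) else None
  end.
have kappa_inj y y' x : kappa y = Some x -> kappa y' = Some x -> y = y'.
  have cov (z : {z | z \in Z0}) (t : T) : covered (A (j (val t)) (val z)).
    by apply/existsP; exists t; apply/exists_inP; exists (val z); rewrite ?(valP z).
  case: y y' => [[z|r] t] [[z'|r'] t'] /=; rewrite /kappa /=.
  - by move=> [<-] [/(injZ _ _ (valP z') (valP z)) [/val_inj -> ->]].
  - by case: eqP => // _ [<-] [E]; have := valP r'; rewrite /= E cov.
  - by case: eqP => // _ [<-] [E]; have := valP r; rewrite /= -E cov.
  - by do 2![case: eqP => // ->]; move=> [<-] [/val_inj ->].
have [iota iotaK] : exists iota : X -> Z * T, forall x, kappa (iota x) = Some x.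
  suff /fin_all_exists : forall x, exists y, kappa y = Some x by [].
  move=> x; case: (boolP (covered x)) => [/existsP[t /exists_inP[z Zz /eqP <-]]|nx].
    by exists (inl (Sub z Zz), t).
  by exists (inr (Sub x nx), t0); rewrite /kappa eqxx.
have kappaK x y : kappa y = Some x -> iota x = y by move=> /(kappa_inj _ _ _ (iotaK x)).
have injiota : injective iota by move=> x x' E; have := iotaK x; rewrite E iotaK => -[].
pose psi g := conj_map kappa iota (A g).
have psiE g x : psi g (iota x) = iota (A g x) by rewrite /psi /conj_map iotaK.
have ZT : #|X| <= #|Z| * #|{: T}| by rewrite -card_prod -(card_codom injiota) max_card.
exists Z, psi; split; first by move: X_gt0 ZT; case: #|Z| => //; lia.
  by move=> g; apply: conj_map_inj.
pose P1 (y : Z * T) := if y.1 is inl z then true else false.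
pose P2 (y : Z * T) := if kappa y is Some x then regular A N x else true.
pose P3 (y : Z * T) := if y.1 is inl z then regular A N (val z) else true.
pose P4 (y : Z * T) := all (fun k => (k * val y.2)%g \in T) K.
pose e (y : Z * T) : X * T := (match y.1 with inl z => val z | inr r => val r end, y.2).
have m1 : mostly (4 * q) P1.
  rewrite /mostly card_prod; apply: leq_trans ZT; apply: leq_trans tileX.
  rewrite /p -[leqRHS]mulnA leq_mul2l; apply/orP; right; rewrite mulnC.
  rewrite -cardX -(card_in_image (f := e)).
    apply/subset_leq_card/subsetP => _ /imageP[[[z|r] t] nz ->] //.
    by rewrite !inE /= andbT; apply: (valP r).
  by move=> [[z|r] t] [[z'|r'] t']; rewrite !inE //= /e /= => _ _ [/val_inj -> ->].
have m2 : mostly (4 * q) P2.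
  rewrite /mostly card_prod; apply: leq_trans ZT; apply: leq_trans regA.
  apply: leq_mul => //; rewrite -(card_image injiota); apply/subset_leq_card/subsetP => y.
  rewrite inE /P2; case E: (kappa y) => [x|] // nx.
  by apply/imageP; exists x; rewrite ?inE ?(kappaK _ _ E).
have m3 : mostly (4 * q) P3.
  rewrite /mostly card_prod; apply: leq_trans ZT; apply: leq_trans regA.
  rewrite /p -[leqRHS]mulnA leq_mul2l; apply/orP; right; rewrite mulnC.
  rewrite -cardX -(card_in_image (f := e)).
    by apply/subset_leq_card/subsetP => _ /imageP[[[z|r] t] nz ->]; rewrite inE /= andbT.
  by move=> [[z|r] t] [[z'|r'] t']; rewrite !inE //= /e /= => _ _ [/val_inj -> ->].
have m4 : mostly (4 * q) P4.
  rewrite /mostly card_prod [#|Z| * _]mulnC.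
  apply: leq_trans (leq_mul iT (leqnn #|Z|)); rewrite -[leqRHS]mulnA leq_mul2l; apply/orP; right.
  rewrite mulnC -cardX; apply/subset_leq_card/subsetP => -[z t].
  by rewrite !inE.
have m12 : mostly (2 * q) (fun y => P1 y && P2 y) by apply: mostlyI; rewrite mulnA.
have m34 : mostly (2 * q) (fun y => P3 y && P4 y) by apply: mostlyI; rewrite mulnA.
apply: mostlyW (leqnn q) _ (mostlyI m12 m34) => -[z t] /andP[/andP[]].
case: z => [z _|] //; rewrite /P2 /P3 /P4 /= => /regularP[multx injx] /andP[/regularP[multz injz] inT].
set x := A _ _ in multx injx *.
have Ex : iota x = (inl z, t) by apply: kappaK.
have NM g : g \in M -> g \in N by rewrite inE mem_cat => ->; rewrite orbT.
have NT s : s \in T -> j s \in N by move=> Ts; rewrite inE !mem_cat map_f ?orbT.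
apply/and4P; split.
- by apply/mult_atP => g h Mg Mh; rewrite -Ex !psiE multx ?NM.
- apply/allP => g Mg; case: eqP => //= g1; rewrite -Ex psiE (inj_eq injiota).
  apply/eqP => gx; apply: g1; apply: injx; [exact: NM | exact: mem_head |].
  by rewrite gx; apply: (injA 1%g); rewrite -multx ?mulg1 //; apply: mem_head.
- apply/allP => h Kh; have Njh : j h \in N by rewrite inE !mem_cat (map_f _ Kh) !orbT.
  rewrite -Ex psiE /x -(multz _ _ Njh (NT _ (valP t))).
  have Tht : (h * val t)%g \in T by apply: (allP inT).
  have -> : iota (A (j h * j (val t))%g (val z)) = (inl z, [` Tht]%fset).
    by apply: kappaK; rewrite /kappa /= gmulfM.
  by rewrite Ex /= !eqxx.
- apply/allP => g Mg; case: asboolP => //= nj; rewrite -Ex psiE.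
  case E: (iota (A g x)) => [z' t'] /=; rewrite ?Ex /=; apply/eqP => zz'.
  (* x = t z and g x = t' z with the same center z force g = t' t^-1. *)
  apply: nj; exists (val t' * (val t)^-1)%g.
  have := iotaK (A g x); rewrite E zz' /kappa /= /x -(multz _ _ (NM _ Mg) (NT _ (valP t))).
  have Ngt : (g * j (val t))%g \in N.
    by rewrite inE !mem_cat (allpairs_f (fun g t => (g * t)%g) Mg (map_f _ (valP t))) !orbT.
  move=> [/injz]; rewrite NT ?(valP t') // Ngt => /(_ isT isT) E'.
  by apply: (mulIg (j (val t))); rewrite -gmulfM mulgVK.
Qed.

End TiledAction.

(** * Finite groups without short relations between given involutions *)

Section PathGroup.
Variables (I : finType) (L : nat).

(** The word [w] is drawn as a path with vertices [0, ..., size w] whose [k]-th edge is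
    labelled by the [k]-th letter; a letter exchanges the ends of the edges that it
    labels.  When adjacent letters differ these edges are disjoint, so this is an
    involution, and reading [w] walks from [0] to [size w]. *)
Definition path_step (w : seq I) (i : I) (k : nat) : nat :=
  if onth w k == Some i then k.+1
  else if (0 < k) && (onth w k.-1 == Some i) then k.-1 else k.

Lemma path_step_le w i k : size w <= L -> k <= L -> path_step w i k <= L.
Proof.
rewrite /path_step => szw lek; case: eqP => [E|_]; last by case: ifP; lia.
by apply: leq_trans szw; rewrite -onthTE E.
Qed.

Lemma path_stepK w i : sorted (fun a b => a != b) w -> involutive (path_step w i).
Proof.
move=> sw; have adj k : onth w k = Some i -> onth w k.+1 != Some i.
  move=> wk; apply/eqP => wk1; have ltk : k.+1 < size w by rewrite -onthTE wk1.
  by have /(sortedP i)/(_ k ltk) := sw; rewrite (@onth_nth _ i _ _ _ wk) (@onth_nth _ i _ _ _ wk1) eqxx.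
move=> k; rewrite {2}/path_step; case: eqP => [wk|nk].
  by rewrite /path_step (negPf (adj _ wk)) /= wk eqxx.
case: ifP => [/andP[k0 /eqP wk]|nk']; first by rewrite /path_step wk eqxx prednK.
by rewrite /path_step; move/eqP/negPf: nk => ->; rewrite nk'.
Qed.

Definition path_act (i : I) (p : L.-bseq I * 'I_L.+1) : L.-bseq I * 'I_L.+1 :=
  if sorted (fun a b => a != b) p.1 then (p.1, inord (path_step p.1 i p.2)) else p.

Lemma path_actK i : involutive (path_act i).
Proof.
case=> w k; rewrite {2}/path_act /=; case: ifP => sw; last by rewrite /path_act /= sw.
rewrite /path_act /= sw inordK ?path_stepK ?inord_val //.
by rewrite ltnS path_step_le ?size_bseq // -ltnS.
Qed.

Definition path_perm (i : I) : {perm L.-bseq I * 'I_L.+1} := perm (can_inj (path_actK i)).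

Lemma path_permK i : (path_perm i * path_perm i)%g = 1%g.
Proof. by apply/permP => p; rewrite permM perm1 !permE path_actK. Qed.

Lemma path_perm_free (s : seq I) : 0 < size s <= L -> sorted (fun a b => a != b) s ->
  (\prod_(i <- s) path_perm i)%g != 1%g.
Proof.
move=> /andP[s0 sL] ss; pose w : L.-bseq I := Bseq sL.
have i0 : I by case: (s) s0.
have walk k : k <= size s -> (\prod_(i <- take k s) path_perm i)%g (w, ord0) = (w, inord k).
  elim: k => [|k IHk] ltk.
    by rewrite take0 big_nil perm1; congr (_, _); apply: val_inj; rewrite /= inordK.
  rewrite (take_nth i0) // -cats1 big_cat big_seq1 permM IHk 1?ltnW // permE /path_act /= ss.
  rewrite inordK ?ltnS; last exact: leq_trans (ltnW ltk) sL.
  have -> // : path_step s (nth i0 s k) k = k.+1.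
  rewrite /path_step; suff -> : onth s k = Some (nth i0 s k) by rewrite eqxx.
  by rewrite onthE (nth_map i0).
apply/eqP => E; have := walk _ (leqnn _); rewrite take_size E perm1 => -[/(congr1 val)].
by rewrite /= inordK // => E0; rewrite -E0 in s0.
Qed.

End PathGroup.

(** The disjoint union of the paths of all words of length at most [L] serves all
    these words at once. *)
Lemma girth_group (I : finType) (L : nat) : exists (Q : finGroupType) (u : I -> Q),
  (forall i, (u i * u i)%g = 1%g) /\
  forall s : seq I, 0 < size s <= L -> sorted (fun a b => a != b) s ->
    (\prod_(i <- s) u i)%g != 1%g.
Proof.
exists {perm L.-bseq I * 'I_L.+1}, (@path_perm I L).
by split; [apply: path_permK | apply: path_perm_free].
Qed.

(** * Words in two groups and the glued model *)

Section Words.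
Variables (H G1 G2 : groupType) (j1 : {multiplicative H -> G1}) (j2 : {multiplicative H -> G2}).
Local Notation letter := (G1 + G2)%type.

Definition act_word (X : Type) (B : letter -> X -> X) (w : seq letter) (x : X) : X :=
  foldr B x w.

Lemma act_word_cat X (B : letter -> X -> X) v w x :
  act_word B (v ++ w) x = act_word B v (act_word B w x).
Proof. exact: foldr_cat. Qed.

Lemma act_word_inj (X : Type) (B : letter -> X -> X) w :
  (forall l, injective (B l)) -> injective (act_word B w).
Proof. by move=> injB; elim: w => [|l w IHw] x y //= /injB/IHw. Qed.

Definition in_amalgam (l : letter) : Prop :=
  match l with inl a => exists h, j1 h = a | inr b => exists h, j2 h = b end.

Definition is_left (l : letter) : bool := if l is inl _ then true else false.

Definition alternating (w : seq letter) : Prop :=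
  sorted (fun l l' => is_left l != is_left l') w /\ {in w, forall l, ~ in_amalgam l}.

Definition trivial_letter (l : letter) : Prop :=
  match l with inl a => a = 1%g | inr b => b = 1%g end.

Definition reduced (w : seq letter) : Prop :=
  (exists2 l, w = [:: l] & ~ trivial_letter l) \/ (0 < size w /\ alternating w).

Definition model_at (M1 : seq G1) (M2 : seq G2) (K : seq H) (X : finType)
    (B : letter -> X -> X) (x : X) : bool :=
  [&& B (inl 1%g) x == x, mult_at (B \o inl) M1 x, mult_at (B \o inr) M2 x
    & all (fun h => B (inl (j1 h)) x == B (inr (j2 h)) x) K].

Lemma model_atS (M1 N1 : seq G1) (M2 N2 : seq G2) (K K' : seq H) (X : finType) (B : letter -> X -> X) x :
  {subset M1 <= N1} -> {subset M2 <= N2} -> {subset K <= K'} ->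
  model_at N1 N2 K' B x -> model_at M1 M2 K B x.
Proof.
move=> s1 s2 sK /and4P[u /mult_atP m1 /mult_atP m2 /allP a]; apply/and4P; split=> //.
- by apply/mult_atP => g h Mg Mh; apply: m1; apply: s1.
- by apply/mult_atP => g h Mg Mh; apply: m2; apply: s2.
- by apply/allP => h Kh; apply/a/sK.
Qed.

(** The two tiled actions share the tile [T].  On [Q * Z1 * Z2 * T] the first group
    acts through [Z1 * T] and the second one through [Z2 * T]; every change of a
    [Z]-coordinate from [z] to [z'] also multiplies the [Q]-coordinate by
    [u z' * u z], which is a cocycle because [u z] is an involution.  The amalgamated
    subgroup only moves [T], so both groups agree on it, whereas an alternating word
    multiplies the [Q]-coordinate by a short reduced product of involutions. *)
Section Gluing.
Variables (T : {fset H}) (Z1 Z2 : finType).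
Variables (psi1 : G1 -> Z1 * T -> Z1 * T) (psi2 : G2 -> Z2 * T -> Z2 * T).
Hypothesis inj1 : forall g, injective (psi1 g).
Hypothesis inj2 : forall g, injective (psi2 g).
Variables (Q : finGroupType) (u : Z1 + Z2 -> Q) (L : nat).
Hypothesis uK : forall i, (u i * u i)%g = 1%g.
Hypothesis u_free : forall s, 0 < size s <= L -> sorted (fun a b => a != b) s ->
  (\prod_(i <- s) u i)%g != 1%g.

Definition glued (l : letter) (x : Q * Z1 * Z2 * T) : Q * Z1 * Z2 * T :=
  let: (q, z1, z2, t) := x in
  match l with
  | inl a => let y := psi1 a (z1, t) in (u (inl y.1) * (u (inl z1) * q), y.1, z2, y.2)%g
  | inr b => let y := psi2 b (z2, t) in (u (inr y.1) * (u (inr z2) * q), z1, y.1, y.2)%g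
  end.

Let uKl i (q : Q) : (u i * (u i * q))%g = q.
Proof. by rewrite mulgA uK mul1g. Qed.

Let u_inj i : injective (fun q => u i * q)%g.
Proof. by move=> q q' E; rewrite -[q](uKl i) E uKl. Qed.

Lemma glued_inj l : injective (glued l).
Proof.
case: l => [a|b] [[[q z1] z2] t] [[[q' z1'] z2'] t'] /= [].
  case E: (psi1 a (z1, t)) => [y s]; case E': (psi1 a (z1', t')) => [y' s'] /= Eq Ey Ez Es.
  have /inj1 [Ez1 Et] : psi1 a (z1, t) = psi1 a (z1', t') by rewrite E E' Ey Es.
  by move: Eq; rewrite Ez1 Ez Et Ey => /u_inj/u_inj ->.
case E: (psi2 b (z2, t)) => [y s]; case E': (psi2 b (z2', t')) => [y' s'] /= Eq Ez Ey Es.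
have /inj2 [Ez2 Et] : psi2 b (z2, t) = psi2 b (z2', t') by rewrite E E' Ey Es.
by move: Eq; rewrite Ez2 Ez Et Ey => /u_inj/u_inj ->.
Qed.

Variables (M1 : seq G1) (M2 : seq G2) (K : seq H).

Definition glued_good (x : Q * Z1 * Z2 * T) : bool :=
  let: (_, z1, z2, t) := x in
  tiled_at j1 psi1 (1%g :: M1) K (z1, t) && tiled_at j2 psi2 M2 K (z2, t).

Lemma mostly_glued_good q :
  mostly (2 * q) (tiled_at j1 psi1 (1%g :: M1) K) -> mostly (2 * q) (tiled_at j2 psi2 M2 K) ->
  mostly q glued_good.
Proof.
move=> m1 m2.
pose e1 (x : Q * Z1 * Z2 * T) : (Z1 * T) * (Q * Z2) :=
  let: (q, z1, z2, t) := x in ((z1, t), (q, z2)).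
pose e2 (x : Q * Z1 * Z2 * T) : (Z2 * T) * (Q * Z1) :=
  let: (q, z1, z2, t) := x in ((z2, t), (q, z1)).
have bij1 : bijective e1.
  by exists (fun y => (y.2.1, y.1.1, y.2.2, y.1.2)) => [[[[? ?] ?] ?]|[[? ?] [? ?]]].
have bij2 : bijective e2.
  by exists (fun y => (y.2.1, y.2.2, y.1.1, y.1.2)) => [[[[? ?] ?] ?]|[[? ?] [? ?]]].
apply: mostlyW (leqnn q) _ (mostlyI (mostly_fst bij1 m1) (mostly_fst bij2 m2)).
by case=> [[[? ?] ?] ?].
Qed.

Lemma glued_good_model x : glued_good x -> model_at M1 M2 K glued x.
Proof.
case: x => [[[q z1] z2] t] /andP[/and4P[/mult_atP m1 _ /allP a1 _] /and4P[/mult_atP m2 _ /allP a2 _]].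
have sM1 g : g \in M1 -> g \in 1%g :: M1 by rewrite inE orbC => ->.
apply/and4P; split.
- have psi11 : psi1 1%g (z1, t) = (z1, t).
    by apply: (inj1 (g := 1%g)); rewrite -m1 ?mem_head // mulg1.
  by rewrite /= psi11 /= uKl.
- apply/mult_atP => g h Mg Mh /=; rewrite m1 ?sM1 //.
  by case: (psi1 h (z1, t)) => [y s] /=; rewrite uKl.
- apply/mult_atP => g h Mg Mh /=; rewrite m2 //.
  by case: (psi2 h (z2, t)) => [y s] /=; rewrite uKl.
apply/allP => h Kh; have /andP[/eqP /= e1 /eqP /= f1] := a1 h Kh.
have /andP[/eqP /= e2 /eqP /= f2] := a2 h Kh.
rewrite /= e1 e2 !uKl; apply/eqP; congr (_, _); apply: val_inj.
by rewrite /= f1 f2.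
Qed.

Definition letters_in (w : seq letter) : bool :=
  all (fun l => match l with inl a => a \in M1 | inr b => b \in M2 end) w.

Definition group_part (x : Q * Z1 * Z2 * T) : Q := x.1.1.1.

Let side (i : Z1 + Z2) : bool := if i is inl _ then true else false.

(** Adjacent letters of [s] differ for two reasons: inside a step, because a letter
    outside the subgroup changes the [Z]-coordinate, and between two steps, because
    these belong to different groups.  The third clause carries the latter through
    the induction. *)
Lemma glued_trace w x : letters_in w -> alternating w ->
  all (fun k => glued_good (act_word glued (drop k w) x)) (iota 1 (size w)) ->
  exists s : seq (Z1 + Z2),
    [/\ size s = (size w).*2, sorted (fun a b => a != b) s,
        forall l i, is_left l = side i -> path (fun l l' => is_left l != is_left l') l w ->
          path (fun a b => a != b) i s
      & group_part (act_word glued w x) = ((\prod_(i <- s) u i) * group_part x)%g].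
Proof.
elim: w => [|l w IHw]; first by exists [::]; split; rewrite // big_nil mul1g.
move=> /andP[Ml Mw] [alt nH] /= /andP[good1 good].
have altw : alternating w.
  split=> [|k wk]; first exact: path_sorted alt.
  by apply: nH; rewrite inE wk orbT.
have [|s [szs _ hds prods]] := IHw Mw altw; first by rewrite (iotaDl 1 1) all_map in good.
rewrite drop0 in good1; set y := act_word glued w x in good1 prods *.
suff [i [i' [nii' si si' step]]] : exists i i', [/\ i != i', side i = is_left l, side i' = is_left l
    & group_part (glued l y) = (u i * (u i' * group_part y))%g].
  have ps : path (fun a b => a != b) i' s by apply: hds alt; rewrite si'.
  exists [:: i, i' & s]; split=> /=.
  - by rewrite szs doubleS.
  - by rewrite nii'.
  - move=> l0 i0 side0 /andP[ll0 _]; rewrite nii' ps !andbT.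
    by apply: contra ll0 => /eqP E; rewrite side0 E si.
  - by rewrite step prods !big_cons -!mulgA.
move: good1; case: (y) => [[[q z1] z2] t]; case: l Ml nH {alt hds good} => [a|b] Ml nH.
  case/andP=> /and4P[_ _ _ /allP/(_ a)]; rewrite inE Ml orbT => /(_ isT).
  case: asboolP => [aH|_ /= nz _]; first by case: (nH (inl a)); rewrite ?mem_head.
  by exists (inl (psi1 a (z1, t)).1), (inl z1).
case/andP=> _ /and4P[_ _ _ /allP/(_ b Ml)].
case: asboolP => [bH|_ /= nz]; first by case: (nH (inr b)); rewrite ?mem_head.
by exists (inr (psi2 b (z2, t)).1), (inr z2).
Qed.

Lemma glued_moves w x : letters_in w -> reduced w -> (size w).*2 <= L ->
  all (fun k => glued_good (act_word glued (drop k w) x)) (iota 1 (size w)) ->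
  act_word glued w x != x.
Proof.
move=> Mw [[l Ew nl]|[w0 altw]] szw good; last first.
  have [s [szs sorts _ prods]] := glued_trace Mw altw good.
  apply/eqP => /(congr1 group_part); rewrite prods => /(canRL (mulgK _)); rewrite mulgV.
  by apply/eqP; apply: u_free; rewrite // szs szw andbT double_gt0.
subst w; rewrite /= in Mw good *; move: Mw good.
case: x => [[[q z1] z2] t]; case: l nl szw => [a|b] /= na _; rewrite !andbT => Ml /andP[].
  case/and4P => _ /allP/(_ a); rewrite inE Ml orbT => /(_ isT); case: eqP => // _ /= ny _ _ _.
  by apply: contra ny => /eqP[_ E1 E2]; rewrite [psi1 _ _]surjective_pairing E1 E2.
move=> _ /and4P[_ /allP/(_ b Ml)]; case: eqP => // _ /= ny _ _.
by apply: contra ny => /eqP[_ E1 E2]; rewrite [psi2 _ _]surjective_pairing E1 E2.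
Qed.

End Gluing.
End Words.

Section AmalgamModel.
Variables (H G1 G2 : groupType) (j1 : {multiplicative H -> G1}) (j2 : {multiplicative H -> G2}).
Hypotheses (injj1 : injective j1) (injj2 : injective j2).
Hypothesis sofic1 : has_almost_actions G1.
Hypothesis sofic2 : has_almost_actions G2.
Hypothesis amenH : has_monotiles H.

Lemma amalgam_model (M1 : seq G1) (M2 : seq G2) (K : seq H) (W : seq (seq (G1 + G2))) q :
  exists (X : finType) (B : G1 + G2 -> X -> X),
    [/\ 0 < #|X|, forall l, injective (B l), mostly q (model_at j1 j2 M1 M2 K B)
      & forall w, w \in W -> reduced j1 j2 w -> mostly q (fun x => act_word B w x != x)].
Proof.
pose m := \max_(w <- W) size w.
have lem w : w \in W -> size w <= m by move=> Ww; apply: leq_bigmax_seq.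
pose N1 := M1 ++ pmap (fun l : G1 + G2 => if l is inl a then Some a else None) (flatten W).
pose N2 := M2 ++ pmap (fun l : G1 + G2 => if l is inr b then Some b else None) (flatten W).
have WN w : w \in W -> letters_in N1 N2 w.
  move=> Ww; apply/allP => l wl; have Wl : l \in flatten W by apply/flattenP; exists w.
  by case: l wl Wl => [a|b] wl Wl; rewrite mem_cat mem_pmap;
    apply/orP; right; apply/mapP; eexists; [exact: Wl| | exact: Wl|].
(* A word of length n visits n points, and the glued model must be good at each. *)
pose q' := q * m.+1.
have [T [tT iT]] := amenH K (4 * (2 * q')).
have [Z1 [psi1 [Z1_gt0 inj1 good1]]] := tiled_action injj1 sofic1 amenH (1%g :: N1) tT iT.
have [Z2 [psi2 [Z2_gt0 inj2 good2]]] := tiled_action injj2 sofic2 amenH N2 tT iT.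
have [Q [u [uK u_free]]] := girth_group (Z1 + Z2)%type m.*2.
exists (Q * Z1 * Z2 * T)%type, (glued psi1 psi2 u).
have injB := glued_inj inj1 inj2 uK.
have good : mostly q' (glued_good (Q := Q) j1 j2 psi1 psi2 N1 N2 K) by apply: mostly_glued_good.
split=> //.
- by rewrite !card_prod !muln_gt0 Z1_gt0 Z2_gt0 (tile_gt0 tT) -cardsT cardG_gt0.
- apply: mostlyW good; first exact: leq_pmulr.
  move=> x /(glued_good_model inj1 uK); apply: model_atS => // g Mg.
    by rewrite mem_cat Mg.
  by rewrite mem_cat Mg.
move=> w Ww redw.
have path_good : mostly q (fun x => all (fun k =>
    glued_good j1 j2 psi1 psi2 N1 N2 K (act_word (glued psi1 psi2 u) (drop k w) x)) (iota 1 (size w))).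
  apply: mostly_all => k _; apply: (mostly_comp (act_word_inj injB)).
  by apply: mostlyW good => //; rewrite size_iota leq_mul // ltnW // ltnS lem.
apply: mostlyW path_good => // x; apply: (glued_moves u_free (WN _ Ww) redw).
by rewrite leq_double lem.
Qed.

End AmalgamModel.

(** * The amalgamated product as a group of words *)

Section AmalgamGroup.
Variables (H G1 G2 : groupType) (j1 : {multiplicative H -> G1}) (j2 : {multiplicative H -> G2}).
Local Notation letter := (G1 + G2)%type.

Inductive relator : seq letter -> seq letter -> Prop :=
| RelUnit : relator [:: inl 1%g] [::]
| RelLeft a b : relator [:: inl a; inl b] [:: inl (a * b)%g]
| RelRight a b : relator [:: inr a; inr b] [:: inr (a * b)%g]
| RelAmalgam h : relator [:: inl (j1 h)] [:: inr (j2 h)].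

Inductive word_cong : seq letter -> seq letter -> Prop :=
| CongRel l r u v : relator l r -> word_cong (u ++ l ++ v) (u ++ r ++ v)
| CongRefl w : word_cong w w
| CongSym w w' : word_cong w w' -> word_cong w' w
| CongTrans w1 w2 w3 : word_cong w1 w2 -> word_cong w2 w3 -> word_cong w1 w3.

Lemma word_cong_ctx u v w w' : word_cong w w' -> word_cong (u ++ w ++ v) (u ++ w' ++ v).
Proof.
elim=> [l r u0 v0 lr|w0|w1 w2 _|w1 w2 w3 _ + _]; last exact: CongTrans.
- by have := CongRel (u ++ u0) (v0 ++ v) lr; rewrite -!catA.
- exact: CongRefl.
- exact: CongSym.
Qed.

Lemma word_cong_cat u u' w w' : word_cong u u' -> word_cong w w' -> word_cong (u ++ w) (u' ++ w').
Proof.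
move=> uu' ww'; apply: (CongTrans (word_cong_ctx [::] w uu')).
by have := word_cong_ctx u' [::] ww'; rewrite !cats0.
Qed.

Lemma word_cong_rel l r : relator l r -> word_cong l r.
Proof. by move/(CongRel [::] [::]); rewrite /= !cats0. Qed.

Lemma multiplicative1 (K L : groupType) (f : {multiplicative K -> L}) : f 1%g = 1%g.
Proof. by apply: (mulgI (f 1%g)); rewrite -gmulfM !mulg1. Qed.

Lemma right_one : word_cong [:: inr 1%g] [::].
Proof.
apply: CongTrans (word_cong_rel RelUnit); apply: CongSym.
by have := word_cong_rel (RelAmalgam 1%g); rewrite !multiplicative1.
Qed.

Definition letter_inv (l : letter) : letter :=
  match l with inl a => inl a^-1%g | inr b => inr b^-1%g end.

Definition word_inv (w : seq letter) := rev (map letter_inv w).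

Lemma letter_invK : involutive letter_inv.
Proof. by case=> a; rewrite /= invgK. Qed.

Lemma word_invK : involutive word_inv.
Proof. by move=> w; rewrite /word_inv map_rev revK mapK //; apply: letter_invK. Qed.

Lemma word_invV w : word_cong (word_inv w ++ w) [::].
Proof.
elim: w => [|l w IHw]; first exact: CongRefl.
rewrite /word_inv /= rev_cons cat_rcons -/(word_inv w).
apply: CongTrans IHw.
have -> : word_inv w ++ [:: letter_inv l, l & w] = word_inv w ++ [:: letter_inv l; l] ++ w by [].
rewrite -[X in word_cong _ (_ ++ X)]cat0s; apply: word_cong_ctx.
case: l => a /=; [apply: CongTrans (word_cong_rel RelUnit) | apply: CongTrans right_one].
  by apply: CongTrans (word_cong_rel (RelLeft _ _)) _; rewrite mulVg; apply: CongRefl.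
by apply: CongTrans (word_cong_rel (RelRight _ _)) _; rewrite mulVg; apply: CongRefl.
Qed.

Definition congb (w w' : seq letter) : bool := `[< word_cong w w' >].

Lemma congb_equiv : equiv_class_of congb.
Proof.
split=> [w|w w'|w2 w1 w3]; first by apply/asboolP; apply: CongRefl.
  by apply/asboolP/asboolP; apply: CongSym.
by move=> /asboolP c12 /asboolP c23; apply/asboolP; apply: CongTrans c12 c23.
Qed.

Canonical cong_equiv := EquivRelPack congb_equiv.

Local Open Scope quotient_scope.

Definition amalgam := {eq_quot cong_equiv}%qT.
HB.instance Definition _ := Choice.on amalgam.

Definition word_class (w : seq letter) : amalgam := \pi_amalgam w.

Lemma word_classP w w' : word_class w = word_class w' <-> word_cong w w'.
Proof. by split=> [/eqmodP/asboolP | c]; last by apply/eqmodP/asboolP. Qed.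

Lemma word_class_repr (x : amalgam) : word_class (repr x) = x.
Proof. exact: reprK. Qed.

Definition amalgam_mul (x y : amalgam) : amalgam := word_class (repr x ++ repr y).
Definition amalgam_inv (x : amalgam) : amalgam := word_class (word_inv (repr x)).
Definition amalgam_one : amalgam := word_class [::].

Lemma word_class_mul w w' : amalgam_mul (word_class w) (word_class w') = word_class (w ++ w').
Proof. by apply/word_classP; apply: word_cong_cat; apply/word_classP; apply: word_class_repr. Qed.

Lemma amalgam_mulA : associative amalgam_mul.
Proof.
move=> x y z; rewrite -(word_class_repr x) -(word_class_repr y) -(word_class_repr z).
by rewrite !word_class_mul catA.
Qed.

Lemma amalgam_mul1 : left_id amalgam_one amalgam_mul.
Proof. by move=> x; rewrite -(word_class_repr x) word_class_mul. Qed.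

Lemma amalgam_mulr1 : right_id amalgam_one amalgam_mul.
Proof. by move=> x; rewrite -(word_class_repr x) word_class_mul cats0. Qed.

Lemma amalgam_mulV : left_inverse amalgam_one amalgam_inv amalgam_mul.
Proof.
move=> x; rewrite -{2}(word_class_repr x) word_class_mul; apply/word_classP.
exact: word_invV.
Qed.

Lemma amalgam_mulrV : right_inverse amalgam_one amalgam_inv amalgam_mul.
Proof.
move=> x; rewrite -{1}(word_class_repr x) word_class_mul; apply/word_classP.
by rewrite -{1}[repr x]word_invK; apply: word_invV.
Qed.

HB.instance Definition _ := isGroup.Build amalgam amalgam_mulA amalgam_mul1 amalgam_mulr1
  amalgam_mulV amalgam_mulrV.

End AmalgamGroup.

Section UniversalProperty.
Variables (H G1 G2 G : groupType) (j1 : {multiplicative H -> G1}) (j2 : {multiplicative H -> G2})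
    (i1 : {multiplicative G1 -> G}) (i2 : {multiplicative G2 -> G}).
Hypothesis hG : is_amalgamated_product j1 j2 i1 i2.
Local Notation letter := (G1 + G2)%type.
Local Notation amalgam := (amalgam j1 j2).
Local Notation word_class := (word_class j1 j2).

Definition eval_letter (l : letter) : G := match l with inl a => i1 a | inr b => i2 b end.
Definition eval_word (w : seq letter) : G := foldr (fun l g => eval_letter l * g)%g 1%g w.

Lemma eval_word_cat v w : eval_word (v ++ w) = (eval_word v * eval_word w)%g.
Proof. by elim: v => [|l v IHv]; rewrite /= ?mul1g // IHv mulgA. Qed.

Lemma eval_word_cong w w' : word_cong j1 j2 w w' -> eval_word w = eval_word w'.
Proof.
have [_ _ i12 _] := hG.
elim=> [l r u v lr|//|w1 w2 _ -> //|w1 w2 w3 _ -> _ -> //].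
rewrite !eval_word_cat; congr (_ * (_ * _))%g.
case: lr => [|a b|a b|h] /=; rewrite ?mulg1 ?gmulfM ?multiplicative1 //.
exact: i12.
Qed.

Definition left_class (a : G1) : amalgam := word_class [:: inl a].
Definition right_class (b : G2) : amalgam := word_class [:: inr b].

Lemma left_class_mul : {morph left_class : a b / (a * b)%g}.
Proof.
move=> a b; rewrite /left_class [RHS](word_class_mul j1 j2); apply/word_classP/CongSym.
exact/word_cong_rel/RelLeft.
Qed.

Lemma right_class_mul : {morph right_class : a b / (a * b)%g}.
Proof.
move=> a b; rewrite /right_class [RHS](word_class_mul j1 j2); apply/word_classP/CongSym.
exact/word_cong_rel/RelRight.
Qed.

Definition eval_class (x : amalgam) : G := eval_word (repr x).

Lemma eval_class_mul : {morph eval_class : x y / (x * y)%g}.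
Proof.
move=> x y; rewrite /eval_class -eval_word_cat; apply: eval_word_cong.
exact/(word_classP j1 j2)/word_class_repr.
Qed.

HB.instance Definition _ := isMultiplicative.Build G1 amalgam left_class left_class_mul.
HB.instance Definition _ := isMultiplicative.Build G2 amalgam right_class right_class_mul.
HB.instance Definition _ := isMultiplicative.Build amalgam G eval_class eval_class_mul.

(** Both claims come from the universal property alone, applied to the group of words:
    the induced morphism sends the value of a word back to its class, and the
    uniqueness clause makes the composite [G -> amalgam -> G] the identity. *)
Lemma eval_word_faithful :
  (forall w w', eval_word w = eval_word w' -> word_cong j1 j2 w w') /\
  (forall g, exists w, eval_word w = g).
Proof.
have [_ _ i12 univ] := hG.
have [f [f1 f2 _]] : exists f : {multiplicative G -> amalgam},
    [/\ f \o i1 =1 left_class, f \o i2 =1 right_class &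
      forall f' : {multiplicative G -> amalgam},
        f' \o i1 =1 left_class -> f' \o i2 =1 right_class -> f' =1 f].
  by apply: univ => h; apply/word_classP/word_cong_rel/RelAmalgam.
have fE w : f (eval_word w) = word_class w.
  elim: w => [|l w IHw]; first exact: multiplicative1.
  rewrite /= gmulfM IHw -cat1s -(word_class_mul j1 j2); congr amalgam_mul.
  by case: l => a; [apply: f1 | apply: f2].
split=> [w w' E|g]; first by apply/(word_classP j1 j2); rewrite -!fE E.
have [k [_ _ uniq]] := univ G i1 i2 i12.
have eval1 l : eval_class (word_class [:: l]) = eval_letter l.
  rewrite -[RHS]mulg1; apply: (eval_word_cong (w' := [:: l])).
  exact/(word_classP j1 j2)/word_class_repr.
have := uniq (eval_class \o f) _ _ g; rewrite -(uniq idfun _ _ g) // => E.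
exists (repr (f g)); apply: E => a /=.
  by rewrite [f _]f1 eval1.
by rewrite [f _]f2 eval1.
Qed.

(** A letter of the common subgroup can be moved to the other factor, so it merges with
    any neighbour. *)
Lemma merge_letters (a b : letter) :
  is_left a = is_left b \/ in_amalgam j1 j2 a \/ in_amalgam j1 j2 b ->
  exists c, eval_letter c = (eval_letter a * eval_letter b)%g.
Proof.
have [_ _ i12 _] := hG.
have same (a' b' : letter) : is_left a' = is_left b' ->
    exists c, eval_letter c = (eval_letter a' * eval_letter b')%g.
  case: a' b' => x [] y //= _; first by exists (inl (x * y)%g); rewrite /= gmulfM.
  by exists (inr (x * y)%g); rewrite /= gmulfM.
have flip (l : letter) side : in_amalgam j1 j2 l ->
    exists l', eval_letter l' = eval_letter l /\ is_left l' = side.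
  case: l => x [h <-]; case: side.
  - by exists (inl (j1 h)).
  - by exists (inr (j2 h)); split=> //; apply/esym/(i12 h).
  - by exists (inl (j1 h)); split=> //; apply: (i12 h).
  - by exists (inr (j2 h)).
case=> [/same //|[/flip|/flip]].
  by move=> /(_ (is_left b))[a' [<- /same]].
by move=> /(_ (is_left a))[b' [<- /esym/same]].
Qed.

Lemma shortest_reduced (w : seq letter) : eval_word w <> 1%g ->
  (forall v, eval_word v = eval_word w -> size w <= size v) -> reduced j1 j2 w.
Proof.
move=> w1 wmin.
have unmergeable u a b v : w = u ++ a :: b :: v ->
    ~ (is_left a = is_left b \/ in_amalgam j1 j2 a \/ in_amalgam j1 j2 b).
  move=> Ew /merge_letters[c Ec]; have := wmin (u ++ c :: v).
  rewrite Ew !eval_word_cat /= Ec -!mulgA => /(_ erefl).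
  by rewrite !size_cat /= !addnS ltnn.
case Ew: w => [|l [|l' w']]; first by rewrite Ew in w1.
  left; exists l => //; case: l Ew => x /= Ew x1; apply: w1;
  by rewrite Ew /= x1 multiplicative1 mulg1.
rewrite -Ew; right; split; first by rewrite Ew.
split.
  apply/(sortedP l) => i lti; apply/eqP => E.
  apply: (unmergeable (take i w) (nth l w i) (nth l w i.+1) (drop i.+2 w)); last by left.
  by rewrite -!drop_nth ?cat_take_drop // ltnW.
move=> k wk kH; case/splitPr: wk Ew unmergeable => u [|b v] Ew unmergeable; last first.
  by apply: (unmergeable u k b v) => //; right; left.
case: (lastP u) Ew unmergeable => [//|u' a] Ew unmergeable.
by apply: (unmergeable u' a k [::]); rewrite ?cat_rcons //; right; right.
Qed.

Lemma reduced_word (g : G) : exists w, eval_word w = g /\ (g <> 1%g -> reduced j1 j2 w).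
Proof.
have [_ surj] := eval_word_faithful.
have ex_size : exists n, `[< exists2 w, eval_word w = g & size w = n >].
  by have [w Ew] := surj g; exists (size w); apply/asboolP; exists w.
case: (ex_minnP ex_size) => n /asboolP[w Ew szw] nmin.
exists w; split=> // g1; apply: shortest_reduced => [|v]; rewrite Ew // => Ev.
by rewrite szw; apply: nmin; apply/asboolP; exists v.
Qed.

End UniversalProperty.

(** * Congruent words act alike in good models *)

Section Conclusion.
Variables (H G1 G2 : groupType) (j1 : {multiplicative H -> G1}) (j2 : {multiplicative H -> G2}).
Local Notation letter := (G1 + G2)%type.

Definition holds_in_models (q : nat) (w w' : seq letter)
    (M1 : seq G1) (M2 : seq G2) (K : seq H) (r : nat) : Prop :=
  forall (X : finType) (B : letter -> X -> X), (forall l, injective (B l)) ->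
    mostly r (model_at j1 j2 M1 M2 K B) ->
    mostly q (fun x => act_word B w x == act_word B w' x).

Lemma holds_in_modelsS q w w' M1 N1 M2 N2 K K' r r' :
  {subset M1 <= N1} -> {subset M2 <= N2} -> {subset K <= K'} -> r <= r' ->
  holds_in_models q w w' M1 M2 K r -> holds_in_models q w w' N1 N2 K' r'.
Proof.
move=> s1 s2 sK ler hold X B injB mB; apply: hold => //.
by apply: mostlyW mB => // x; apply: model_atS.
Qed.

(** A derivation of a congruence uses finitely many relators, each at one suffix of a
    word; the points where one of them fails are as few as one likes. *)
Lemma word_cong_models w w' : word_cong j1 j2 w w' ->
  forall q, exists M1 M2 K r, holds_in_models q w w' M1 M2 K r.
Proof.
elim=> [l r u v lr|w0|w1 w2 _ IH|w1 w2 w3 _ IH12 _ IH23] q.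
- suff [M1 [M2 [K hold]]] : exists M1 M2 K, forall (X : finType) (B : letter -> X -> X) x,
      model_at j1 j2 M1 M2 K B x -> act_word B l x = act_word B r x.
    exists M1, M2, K, q => X B injB mB.
    apply: mostlyW (leqnn q) _ (mostly_comp (act_word_inj injB (w := v)) mB) => x mx.
    by rewrite !act_word_cat (hold X B) .
  case: lr => [|a b|a b|h].
  + by exists [::], [::], [::] => X B x /and4P[/eqP].
  + exists [:: a; b], [::], [::] => X B x /and4P[_ /mult_atP m1 _ _] /=.
    by rewrite -[LHS]m1 ?inE ?eqxx ?orbT.
  + exists [::], [:: a; b], [::] => X B x /and4P[_ _ /mult_atP m2 _] /=.
    by rewrite -[LHS]m2 ?inE ?eqxx ?orbT.
  + by exists [::], [::], [:: h] => X B x /and4P[_ _ _]; rewrite /= andbT => /eqP.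
- exists [::], [::], [::], 0 => X B _ _; rewrite /mostly eq_card0 ?muln0 // => x.
  by rewrite !inE eqxx.
- have [M1 [M2 [K [r hold]]]] := IH q; exists M1, M2, K, r => X B injB /(hold X B injB).
  by apply: mostlyW => // x; rewrite eq_sym.
have [M1 [M2 [K [r hold12]]]] := IH12 (2 * q).
have [N1 [N2 [K' [r' hold23]]]] := IH23 (2 * q).
exists (M1 ++ N1), (M2 ++ N2), (K ++ K'), (maxn r r') => X B injB mB.
have m12 : mostly (2 * q) (fun x => act_word B w1 x == act_word B w2 x).
  apply: (holds_in_modelsS _ _ _ _ hold12) mB => //; rewrite ?leq_maxl //;
  by move=> g Mg; rewrite mem_cat Mg.
have m23 : mostly (2 * q) (fun x => act_word B w2 x == act_word B w3 x).
  apply: (holds_in_modelsS _ _ _ _ hold23) mB => //; rewrite ?leq_maxr //;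
  by move=> g Mg; rewrite mem_cat Mg orbT.
by apply: mostlyW (leqnn q) _ (mostlyI m12 m23) => x /andP[/eqP -> /eqP ->].
Qed.

Lemma finite_word_cong_models q (P : seq (seq letter * seq letter)) :
  {in P, forall p, word_cong j1 j2 p.1 p.2} ->
  exists M1 M2 K r, {in P, forall p, holds_in_models q p.1 p.2 M1 M2 K r}.
Proof.
elim: P => [|p P IHP] congP; first by exists [::], [::], [::], 0.
have [|M1 [M2 [K [r hold]]]] := IHP; first by move=> p' Pp'; apply: congP; rewrite inE Pp' orbT.
have [N1 [N2 [K' [r' holdp]]]] := word_cong_models (congP p (mem_head _ _)) q.
exists (M1 ++ N1), (M2 ++ N2), (K ++ K'), (maxn r r') => p'; rewrite inE => /predU1P[->|Pp'].
  apply: (holds_in_modelsS _ _ _ _ holdp); rewrite ?leq_maxr //;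
  by move=> g Mg; rewrite mem_cat Mg orbT.
apply: (holds_in_modelsS _ _ _ _ (hold p' Pp')); rewrite ?leq_maxl //;
by move=> g Mg; rewrite mem_cat Mg.
Qed.

End Conclusion.

(** * The amalgamated product is sofic *)

Theorem theorem3p4 (R : realType) (H G1 G2 G : groupType)
    (j1 : {multiplicative H -> G1}) (j2 : {multiplicative H -> G2})
    (i1 : {multiplicative G1 -> G}) (i2 : {multiplicative G2 -> G})
    (hG : is_amalgamated_product j1 j2 i1 i2)
    (hG1 : sofic R G1) (hG2 : sofic R G2)
    (hH : monotileably_amenable R H) :
  sofic R G.
Proof.
have [injj1 injj2 _ _] := hG.
have sofic1 := sofic_almost_action hG1.
have sofic2 := sofic_almost_action hG2.
have amenH := almost_invariant_monotile hH.
have [faithful _] := eval_word_faithful hG.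
(* Each element acts through a chosen reduced word. *)
have [rep repP] := boolp.choice (reduced_word hG).
have repE g : eval_word i1 i2 (rep g) = g by have [] := repP g.
apply: almost_action_sofic => M q.
pose n := q * size M * size M.
pose P := [seq (rep (g * h)%g, rep g ++ rep h) | g <- M, h <- M].
have [|M1 [M2 [K [r holdP]]]] := finite_word_cong_models n (P := P) (j1 := j1) (j2 := j2).
  by move=> _ /allpairsP[[g h] [_ _ ->]]; apply: faithful; rewrite eval_word_cat !repE.
have [X [B [X_gt0 injB mB freeB]]] :=
  amalgam_model injj1 injj2 sofic1 sofic2 amenH M1 M2 K (map rep M) (maxn r n).
exists X, (fun g => act_word B (rep g)); split=> //.
- by move=> g; apply: act_word_inj.
- apply: mostly_all => g Mg; apply: mostly_all => h Mh.
  have Pgh : (rep (g * h)%g, rep g ++ rep h) \in P.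
    exact: (allpairs_f (fun g h => (rep (g * h)%g, rep g ++ rep h)) Mg Mh).
  have := holdP _ Pgh X B injB; rewrite /=; move=> /(_ (mostlyW (leq_maxl r n) (fun _ => id) mB)).
  by apply: mostlyW => // x; rewrite act_word_cat.
apply: mostly_all => g Mg; case: eqP => [_|g1] /=; first by rewrite /mostly eq_card0 ?muln0.
have := freeB _ (map_f _ Mg) ((repP g).2 g1); apply: mostlyW => //.
apply: leq_trans (leq_maxr r n).
by rewrite /n leq_pmulr //; case: (M) Mg.
Qed.
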